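(* Let $1\le r<p\le\infty$. If $T:AC_r\to AC_p$ is a multiplier, then $T=0$.
   Context: For $1\le p\le\infty$, $AC_p$ denotes the algebra (under pointwise operations) of absolutely continuous functions $f:[0,1]\to\mathbb{C}$ with $f(0)=0$ and $f'\in L^p[0,1]$, with norm $|||f|||=\|f'\|_p$. A multiplier $T:AC_r\to AC_p$ is a map given by a continuous (not necessarily bounded) function $m:(0,1]\to\mathbb{C}$ via $Tg=mg$, where $mg\in AC_p$ for every $g\in AC_r$; here $mg$ denotes the function on $[0,1]$ equal to $m(t)g(t)$ for $t\in(0,1]$ and to $0$ at $t=0$. *)

(* Defs.v *)
From HB Require Import structures.
From mathcomp Require Import all_boot all_order all_algebra.
From mathcomp Require Import all_classical all_reals all_analysis.
From mathcomp Require Import complex.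

Set Implicit Arguments.
Unset Strict Implicit.
Unset Printing Implicit Defensive.
Import Order.TTheory GRing.Theory Num.Theory.
Import numFieldNormedType.Exports.

Local Open Scope classical_set_scope.
Local Open Scope ring_scope.
Local Open Scope complex_scope.

(* R[i] viewed as a numFieldType, which is what gives it its norm topology:
   the bare type R[i] carries no topological structure in the libraries. *)
Definition Cplx (R : realType) : numFieldType := R[i].

(* A function on [0,1] is represented by a total function R -> Cplx R of which
   only the restriction to [0,1] matters: each notion below depends only on the
   values of f on [0,1] (for derivatives, at interior points). *)

Definition absolutely_continuous01 (R : realType) (f : R -> Cplx R) : Prop :=
  forall e : R, 0 < e -> exists2 d : R, 0 < d &
    forall (n : nat) (a b : 'I_n -> R),
      (forall i, 0 <= a i /\ a i <= b i /\ b i <= 1) ->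
      trivIset setT (fun i => `]a i, b i[%classic) ->
      \sum_(i < n) (b i - a i) < d ->
      \sum_(i < n) Normc.normc (f (b i) - f (a i)) < e.

Definition has_derivative (R : realType) (f : R -> Cplx R) (t : R)
    (l : Cplx R) : Prop :=
  (f (t + h) - f t) / (h%:C : Cplx R) @[h --> (0 : R)^'] --> l.

(* Here f \_ D extends f by 0 outside D, since 0 is the default point of \bar R. *)
Definition in_Lp01 (R : realType) (p : \bar R) (g : R -> Cplx R) : Prop :=
  [/\ measurable_fun `[(0 : R), 1] (fun t => complex.Re (g t)),
      measurable_fun `[(0 : R), 1] (fun t => complex.Im (g t)) &
      ('N[@lebesgue_measure R]_p[
         (fun t => (Normc.normc (g t))%:E) \_ `[(0 : R)%R, 1%R]] < +oo)%E].

(* As an element of L^p[0,1], f' is an almost-everywhere class, given by any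
   representative g that agrees with the pointwise derivative a.e. *)
Definition in_ACp (R : realType) (p : \bar R) (f : R -> Cplx R) : Prop :=
  [/\ absolutely_continuous01 f,
      f 0 = 0 &
      exists2 g : R -> Cplx R,
        {ae @lebesgue_measure R, forall t, 0 < t < 1 -> has_derivative f t (g t)}
        & in_Lp01 p g].

Record ACp (R : realType) (p : \bar R) := MkACp {
  ACp_fun :> R -> Cplx R ;
  ACp_funP : in_ACp p ACp_fun }.

Definition mul_ext0 (R : realType) (m g : R -> Cplx R) (t : R) : Cplx R :=
  if t == 0 then 0 else m t * g t.

(* Since T g lies in ACp p by its type, the equation on [0,1] says in particular
   that the function m g belongs to AC_p for every g in AC_r. *)
Definition is_multiplier (R : realType) (r p : \bar R) (T : ACp r -> ACp p)
    : Prop :=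
  exists2 m : R -> Cplx R, {within `]0, 1], continuous m} &
    forall (g : ACp r) (t : R), 0 <= t <= 1 -> T g t = mul_ext0 m g t.

(* Main.v *)
Require Import Defs.
From mathcomp Require Import all_boot all_order all_algebra.
From mathcomp Require Import all_classical all_reals all_analysis.
From mathcomp Require Import measurable_realfun ess_sup_inf complex ring lra.

(* Suppose m(t0) <> 0; by continuity |m| is bounded and bounded away from 0 on
   some ]s, t1] in ]0, 1[. Take a finite q with r < q <= p and the functions id and
   f(t) = max(0, t - s)^(1 - 1/q), both in AC_r. Then M = m id and N = m f lie
   in AC_p, and differentiating N id = M f gives M f' = N' id + N - M' f, so f'
   is bounded on ]s, t1] by a multiple of |N'| + |M'| + 1, hence lies in L^q
   there. But f'^q is a multiple of 1/(t - s), whose integral diverges. *)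

Set Implicit Arguments.
Unset Strict Implicit.
Unset Printing Implicit Defensive.
Import Order.TTheory GRing.Theory Num.Theory.
Import numFieldNormedType.Exports.

Local Open Scope classical_set_scope.
Local Open Scope ring_scope.
Local Open Scope complex_scope.

(** * Complex modulus and derivatives of complex functions of a real variable *)

(** The norm of [Cplx R] takes its values in [Cplx R] itself; this links it to the real-valued
    [Normc.normc] of the definitions. *)
Lemma normr_normc (R : realType) (z : Cplx R) : `|z| = (Normc.normc z)%:C.
Proof. by rewrite normc_def; case: z. Qed.

Lemma normc_real (R : realType) (x : R) : Normc.normc x%:C = `|x|.
Proof. by rewrite /= expr0n addr0 sqrtr_sqr. Qed.

Lemma normcB_real (R : realType) (x y : R) : Normc.normc (x%:C - y%:C) = `|x - y|.
Proof. by rewrite -rmorphB normc_real. Qed.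

Lemma cvg_real_complex (R : realType) (T : Type) (F : set_system T)
    (FF : Filter F) (f : T -> R) (l : R) :
  f x @[x --> F] --> l -> ((f x)%:C : Cplx R) @[x --> F] --> (l%:C : Cplx R).
Proof.
move=> fl; apply/cvgrPdist_lt => e e0.
(* In the order on complex numbers, 0 < e forces e to be real. *)
have [re Ime] : 0 < complex.Re e /\ complex.Im e = 0.
  by move: e0; rewrite ltcE /= => /andP[/eqP].
near=> x; rewrite -rmorphB normr_normc normc_real ltcE /= Ime eqxx /=.
by near: x; move/cvgrPdist_lt: fl; exact.
Unshelve. all: by end_near. Qed.

Lemma near_has_derivative (R : realType) (f g : R -> Cplx R) (t : R) (l : Cplx R) :
  (\forall x \near t, f x = g x) -> has_derivative f t l -> has_derivative g t l.
Proof.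
move=> fg; rewrite /has_derivative => fl.
apply: cvg_trans fl; apply: near_eq_cvg.
have ft := nbhs_singleton fg.
have ct : (t + h) @[h --> (0 : R)] --> t.
  by rewrite -[X in _ --> X]addr0; apply: cvgD; [exact: cvg_cst|exact: cvg_id].
by near=> h; rewrite /= ft; congr ((_ - _) / _); near: h;
  exact: (@cvg_within_filter _ _ (fun h => t + h) (nbhs (0 : R)) _ _ (fun h => h != 0) ct _ fg).
Unshelve. all: by end_near. Qed.

Lemma has_derivative_unique (R : realType) (f : R -> Cplx R) (t : R) (k l : Cplx R) :
  has_derivative f t k -> has_derivative f t l -> k = l.
Proof. by apply: cvg_unique; exact: norm_hausdorff. Qed.

Lemma has_derivative_shift_cvg (R : realType) (f : R -> Cplx R) (t : R) (l : Cplx R) :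
  has_derivative f t l -> f (t + h) @[h --> (0 : R)^'] --> f t.
Proof.
move=> fl.
have h0 : (h%:C : Cplx R) @[h --> (0 : R)^'] --> (0 : Cplx R).
  by apply: cvg_real_complex; apply: cvg_within_filter; exact: cvg_id.
(* For h != 0, f(t + h) is f(t) plus h times the difference quotient. *)
rewrite -[X in _ --> X](addr0 (f t)) -[X in _ + X](mulr0 l).
apply: cvg_trans (cvgD (cvg_cst (f t)) (cvgM fl h0)).
apply: near_eq_cvg; near=> h; rewrite !fctE /= divfK ?[f t + _]addrC ?subrK//.
by rewrite eq_complex /= eqxx andbT; near: h; exact: nbhs_dnbhs_neq.
Unshelve. all: by end_near. Qed.

(** The increment of the product splits as (f(t + h) - f(t)) g(t + h) + f(t) (g(t + h) - g(t)). *)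
Lemma has_derivativeM (R : realType) (f g : R -> Cplx R) (t : R) (k l : Cplx R) :
  has_derivative f t k -> has_derivative g t l ->
  has_derivative (fun x => f x * g x) t (k * g t + f t * l).
Proof.
move=> fk gl; rewrite /has_derivative.
have gt := has_derivative_shift_cvg gl.
apply: cvg_trans (cvgD (cvgM fk gt) (cvgM (cvg_cst (f t)) gl)).
by apply: near_eq_cvg; near=> h; rewrite !fctE /=; ring.
Unshelve. all: by end_near. Qed.

Lemma is_derive_has_derivative (R : realType) (f : R -> R) (t l : R) :
  is_derive t 1 f l -> has_derivative (fun x => (f x)%:C : Cplx R) t l%:C.
Proof.
move=> [df <-]; rewrite /has_derivative /derive.
have -> : (fun h : R => ((f (t + h))%:C - (f t)%:C : Cplx R) / h%:C) =
          (fun h : R => (h^-1 *: (f (h *: (1 : R) + t) - f t))%:C : Cplx R).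
  apply/funext => h.
  rewrite [h *: 1]mulr1 [h + t]addrC [_ *: _]mulrC.
  by rewrite rmorphM fmorphV rmorphB.
by apply: cvg_real_complex; exact: df.
Qed.

(** * Integrals over []s, b]] of functions with a known primitive *)

Section primitive_on_ray.
Context (R : realType) (F f : R -> R) (s : R).
Hypothesis dF : forall t, s < t -> is_derive t 1 F (f t).
Hypothesis cf : forall t, s < t -> {for t, continuous f}.

Lemma measurable_fun_ray (A : set R) :
  measurable A -> A `<=` `]s, +oo[ -> measurable_fun A f.
Proof.
move=> mA sA; apply: measurable_funS sA _; first exact: measurable_itv.
apply: open_continuous_measurable_fun; first exact: interval_open.
by move=> t; rewrite inE /= in_itv /= andbT; exact: cf.
Qed.

Lemma integral_primitive (a b : R) : s < a -> a < b ->
  (\int[lebesgue_measure]_(t in `[a, b]) (f t)%:E = (F b - F a)%:E)%E.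
Proof.
move=> sa ab.
have cF t : s < t -> {for t, continuous F}.
  by move=> /dF[dFt _]; exact/differentiable_continuous/derivable1_diffP.
rewrite (@continuous_FTC2 _ _ F)//.
- apply: continuous_in_subspaceT => t; rewrite inE /= in_itv /= => /andP[at_ _].
  by apply: cf; exact: lt_le_trans at_.
- split.
  + move=> t; rewrite in_itv /= => /andP[at_ _].
    by have [] := dF (lt_trans sa at_).
  + by apply: cvg_at_right_filter; exact: cF.
  + by apply: cvg_at_left_filter; apply: cF; exact: lt_trans ab.
- move=> t; rewrite in_itv /= => /andP[at_ _].
  by rewrite derive1E; have [_ ->] := dF (lt_trans sa at_).
Qed.

Hypothesis f0 : forall t, s < t -> 0 <= f t.

(** As [f] may blow up at [s], the fundamental theorem is applied on the increasing intervals
    [[a n, b]], and the bound passes to their union []s, b]] by monotone convergence. *)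
Lemma integral_oc_primitive_le (b K : R) : s < b ->
  (forall a, s < a -> a < b -> F b - F a <= K) ->
  (\int[lebesgue_measure]_(t in `]s, b]) (f t)%:E <= K%:E)%E.
Proof.
move=> sb FK.
(* The denominator n + 2 keeps [a n] strictly below [b] even for n = 0. *)
pose a n : R := s + (b - s) / n.+2%:R.
have sa n : s < a n by rewrite /a ltrDl divr_gt0 ?subr_gt0.
have ab n : a n < b.
  rewrite /a -ltrBrDl ltr_pdivrMr ?ltr0n// ltr_pMr ?subr_gt0//.
  by rewrite ltr1n.
pose D n : set R := `[a n, b]%classic.
have DE : `]s, b]%classic = \bigcup_n D n.
  apply/seteqP; split => t /=.
    rewrite in_itv /= => /andP[st tb].
    have [n n_lt] : exists n : nat, (b - s) / (t - s) < n%:R.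
      exists (Num.truncn ((b - s) / (t - s))).+1.
      exact: truncnS_gt.
    exists n => //; rewrite /D /= in_itv /= tb andbT /a -lerBrDl.
    rewrite ler_pdivrMr ?ltr0n// mulrC -ler_pdivrMr ?subr_gt0//.
    by apply/(le_trans (ltW n_lt)); rewrite ler_nat -addn2 leq_addr.
  move=> [n _]; rewrite /D /= !in_itv /= => /andP[an ->].
  by rewrite (lt_le_trans (sa n) an).
have cvgD : (\int[lebesgue_measure]_(t in D i) (f t)%:E @[i --> \oo] -->
    \int[lebesgue_measure]_(t in \bigcup_i D i) (f t)%:E)%E.
  apply: ge0_nondecreasing_set_cvg_integral.
  - move=> m n mn; apply/subsetPset => t; rewrite /D /= !in_itv /= => /andP[am ->].
    rewrite andbT (le_trans _ am)// /a lerD2l ler_pM2l ?subr_gt0//.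
    by rewrite lef_pV2 ?posrE ?ltr0n// ler_nat.
  - by move=> n; exact: measurable_itv.
  - move=> n; apply/measurable_EFinP; apply: measurable_fun_ray.
      exact: measurable_itv.
    move=> t; rewrite /D /= !in_itv /= andbT => /andP[+ _].
    exact: lt_le_trans.
  - move=> n t; rewrite /D /= in_itv /= => /andP[ant _].
    by rewrite lee_fin f0// (lt_le_trans (sa n) ant).
rewrite DE -(cvg_lim _ cvgD)//; apply: lime_le; first by apply/cvg_ex; eexists; exact: cvgD.
by apply: nearW => n; rewrite integral_primitive// lee_fin FK.
Qed.

Lemma integral_oc_primitive_ge (a b : R) : s < a -> a < b ->
  ((F b - F a)%:E <= \int[lebesgue_measure]_(t in `]s, b]) (f t)%:E)%E.
Proof.
move=> sa ab; rewrite -integral_primitive//; apply: ge0_subset_integral => //.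
- apply/measurable_EFinP; apply: measurable_fun_ray => // t /=.
  by rewrite !in_itv /= andbT => /andP[].
- by move=> t /=; rewrite in_itv /= => /andP[st _]; rewrite lee_fin f0.
- move=> t /=; rewrite !in_itv /= => /andP[at_ ->]; rewrite andbT.
  exact: lt_le_trans at_.
Qed.

End primitive_on_ray.

(** * Powers and the inverse of the distance to [s] *)

Lemma is_derive1_shift_powR (R : realType) (s c t : R) : s < t ->
  is_derive t 1 (fun x => (x - s) `^ c) (c * (t - s) `^ (c - 1)).
Proof.
move=> st; rewrite -[X in is_derive _ _ _ X]mulr1.
have ? : is_derive (t - s) 1 (fun x : R => x `^ c) (c * (t - s) `^ (c - 1)).
  by apply: is_derive1_powR; rewrite subr_gt0.
apply: (@is_derive1_comp _ (fun x : R => x `^ c) (fun x => x - s)).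
by apply: is_derive_eq; rewrite subr0.
Qed.

Lemma continuous_shift_powR (R : realType) (s c t : R) : s < t ->
  {for t, continuous (fun x : R => (x - s) `^ c)}.
Proof.
move=> st; apply/differentiable_continuous/derivable1_diffP.
by have [] := is_derive1_shift_powR c st.
Qed.

(** The primitive (t - s)^c is nonnegative, so its increments up to [b] are at most (b - s)^c. *)
Lemma integral_shift_powR_lty (R : realType) (s b c : R) : s < b -> 0 < c ->
  (\int[lebesgue_measure]_(t in `]s, b]) (c * (t - s) `^ (c - 1))%:E < +oo)%E.
Proof.
move=> sb c0.
apply: (@le_lt_trans _ _ ((b - s) `^ c)%:E); last exact: ltry.
apply: (@integral_oc_primitive_le _ (fun t => (t - s) `^ c)) => //.
- by move=> t st; exact: is_derive1_shift_powR.
- move=> t st.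
  by apply: continuousM; [exact: cvg_cst|exact: continuous_shift_powR].
- by move=> t _; rewrite mulr_ge0 ?powR_ge0 ?ltW.
- by move=> a _ _; rewrite gerBl powR_ge0.
Qed.

Lemma continuous_shift_inv (R : realType) (s t : R) : s < t ->
  {for t, continuous (fun x : R => (x - s)^-1)}.
Proof.
move=> st; apply: continuousV; first by rewrite subr_eq0 gt_eqF.
by apply: continuousB; [exact: cvg_id|exact: cvg_cst].
Qed.

Lemma integral_shift_invy (R : realType) (s b : R) : s < b ->
  (\int[lebesgue_measure]_(t in `]s, b]) ((t - s)^-1)%:E = +oo)%E.
Proof.
move=> sb; apply/eqyP => A A0.
(* Chosen so that ln(b - s) - ln e = A + |ln(b - s)|, which is at least A; it is positive, so e < b
   - s. *)
pose e : R := expR (- (A + `|ln (b - s)|)) * (b - s).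
have e0 : 0 < e by rewrite mulr_gt0 ?expR_gt0 ?subr_gt0.
have eb : e < b - s.
  rewrite gtr_pMl ?subr_gt0// expR_lt1 oppr_lt0.
  by rewrite ltr_wpDr.
apply: le_trans (@integral_oc_primitive_ge _ (fun t => ln (t - s))
  (fun t => (t - s)^-1) s _ _ _ (s + e) b _ _); last first.
- by rewrite -ltrBrDl.
- by rewrite ltrDl.
- by move=> t st; rewrite invr_ge0 subr_ge0 ltW.
- by move=> t; exact: continuous_shift_inv.
- move=> t st; rewrite -[X in is_derive _ _ _ X]mulr1.
  apply: (@is_derive1_comp _ (@ln R) (fun x => x - s)).
    by apply: is_derive1_ln; rewrite subr_gt0.
  by apply: is_derive_eq; rewrite subr0.
- rewrite lee_fin addrAC subrr add0r /e lnM ?posrE ?expR_gt0 ?subr_gt0// expRK.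
  by rewrite opprD opprK addrCA subrr addr0 lerDl.
Qed.

(** * Absolute continuity of the test functions *)

Section absolute_continuity.
Context (R : realType).

(* The images of disjoint intervals under a monotone function are disjoint, so
   Lebesgue measure adds up their lengths. *)
Lemma sum_increments_le (g : R -> R) (x y : R) (n : nat) (a b : 'I_n -> R) :
  {homo g : s t / s <= t} -> (forall t, x <= g t <= y) -> x <= y ->
  (forall i, a i <= b i) ->
  trivIset setT (fun i => `]a i, b i[%classic) ->
  \sum_(i < n) (g (b i) - g (a i)) <= y - x.
Proof.
move=> g_homo gxy xy ab tI.
pose J i : set R := `]g (a i), g (b i)[%classic.
have mJ i : measurable (J i) by exact: measurable_itv.
have tJ : trivIset setT J.
  (* Degenerate intervals with [a i = b i] are allowed. For two nondegenerate ones these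
     inequalities would put the midpoint of []u, v[] in both. *)
  have sep i j : i != j -> a i < b j -> a j < b i -> b i = a i \/ b j = a j.
    move=> ij aibj ajbi; apply: contrapT => /not_orP[/eqP bai /eqP baj].
    have ai : a i < b i by rewrite lt_neqAle eq_sym bai ab.
    have aj : a j < b j by rewrite lt_neqAle eq_sym baj ab.
    have /trivIsetP/(_ i j Logic.I Logic.I ij)/seteqP[+ _] := tI.
    pose u := Num.max (a i) (a j); pose v := Num.min (b i) (b j).
    have uv : u < v by rewrite /u /v lt_min !gt_max ai aj aibj ajbi.
    move=> /(_ ((u + v) / 2)); apply.
    have [uw wv] := midf_lt uv.
    split; rewrite /= in_itv /=; apply/andP; split.
    - by apply: le_lt_trans uw; rewrite /u le_max lexx.
    - by apply: (lt_le_trans wv); rewrite /v ge_min lexx.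
    - by apply: le_lt_trans uw; rewrite /u le_max lexx orbT.
    - by apply: (lt_le_trans wv); rewrite /v ge_min lexx orbT.
  have g_lt s t : g s < g t -> s < t.
    by move=> gst; rewrite ltNge; apply/negP => /g_homo; rewrite leNgt gst.
  apply/trivIsetP => i j _ _ ij; apply/seteqP; split => // z [].
  rewrite /J /= !in_itv /= => /andP[aiz zbi] /andP[ajz zbj].
  have [||E|E] := sep i j ij.
  - by apply: g_lt; exact: lt_trans zbj.
  - by apply: g_lt; exact: lt_trans zbi.
  - by have := lt_trans aiz zbi; rewrite E ltxx.
  - by have := lt_trans ajz zbj; rewrite E ltxx.
have JE i : lebesgue_measure (J i) = (g (b i) - g (a i))%:E.
  rewrite /J lebesgue_measure_itv /= lte_fin.
  case: ltP => // gba; rewrite (_ : g (b i) = g (a i)) ?subrr//.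
  by apply/eqP; rewrite eq_le gba g_homo.
rewrite -lee_fin -sumEFin.
under eq_bigr do rewrite -JE.
rewrite -(@measure_bigsetU_ord _ _ _ lebesgue_measure n xpredT J mJ tJ).
have := @lebesgue_measure_itv R `[x, y].
rewrite /= lte_fin => xyE.
have -> : ((y - x)%:E = lebesgue_measure (`[x, y]%classic : set R))%E.
  rewrite xyE; case: ltP => // yx.
  by rewrite (_ : y = x) ?subrr//; apply/eqP; rewrite eq_le xy yx.
apply: le_measure; rewrite ?inE; [|exact: measurable_itv|].
  by apply: bigsetU_measurable => i _; exact: mJ.
rewrite -bigcup_seq => z [i _]; rewrite /J /= !in_itv /= => /andP[ai zb].
have /andP[xa _] := gxy (a i); have /andP[_ by_] := gxy (b i).
by rewrite (le_trans xa (ltW ai)) (le_trans (ltW zb) by_).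
Qed.

(** Over disjoint intervals the monotone part [g] contributes at most its total rise, and the
    Lipschitz part [h] at most [L] times the total length; each share is kept within e / 2. *)
Lemma absolutely_continuous01_split (f : R -> R) :
  (forall e, 0 < e -> exists (g h : R -> R) (L : R),
    [/\ f =1 g \+ h, {homo g : s t / s <= t}, forall t, 0 <= g t <= e, 0 <= L &
        forall s t, s <= t -> `|h t - h s| <= L * (t - s)]) ->
  absolutely_continuous01 (fun t => (f t)%:C : Cplx R).
Proof.
move=> fgh e e0; have e20 : 0 < e / 2 by rewrite divr_gt0.
have [g [h [L [fE g_homo ge L0 hL]]]] := fgh _ e20.
have L1 : 0 < L + 1 by rewrite ltr_wpDl.
(* Dividing by L + 1 also covers L = 0. *)
exists (e / 2 / (L + 1)); first by rewrite divr_gt0.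
move=> n a b ab tI sumd.
have incr i : Normc.normc ((f (b i))%:C - (f (a i))%:C) <=
    (g (b i) - g (a i)) + L * (b i - a i).
  have [_ [abi _]] := ab i.
  rewrite normcB_real !fE /= opprD addrACA.
  apply: (le_trans (ler_normD _ _)); apply: lerD; last exact: hL.
  by rewrite ger0_norm// subr_ge0 g_homo.
apply: (le_lt_trans (ler_sum _ (fun i _ => incr i))).
rewrite big_split /= -mulr_sumr.
have g_le : \sum_(i < n) (g (b i) - g (a i)) <= e / 2.
  rewrite -[leRHS]subr0; apply: sum_increments_le => //; first exact: ltW.
  by move=> i; have [_ []] := ab i.
have L_lt : L * (\sum_(i < n) (b i - a i)) < e / 2.
  have S0 : 0 <= \sum_(i < n) (b i - a i).
    by apply: sumr_ge0 => i _; have [_ [? _]] := ab i; rewrite subr_ge0.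
  move: sumd; rewrite ltr_pdivlMr// => sumd.
  by apply: le_lt_trans sumd; rewrite mulrC ler_wpM2l// lerDl.
by lra.
Qed.

Lemma absolutely_continuous01_id :
  absolutely_continuous01 (fun t : R => t%:C : Cplx R).
Proof.
apply: (absolutely_continuous01_split (f := idfun)) => e e0.
exists (cst 0), idfun, 1; split => //=.
- by move=> t /=; rewrite add0r.
- by move=> t; rewrite lexx ltW.
- by move=> s t st; rewrite mul1r ger0_norm// subr_ge0.
Qed.

(** Since u^(c - 1) decreases in u, z^c = z^(c - 1) z is at most y^(c - 1) z; subtracting y^c leaves
    y^(c - 1) (z - y), and y^(c - 1) is at most x^(c - 1). *)
Lemma powR_increment_le (c x y z : R) : 0 < c -> c <= 1 -> 0 < x -> x <= y ->
  y <= z -> z `^ c - y `^ c <= x `^ (c - 1) * (z - y).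
Proof.
move=> c0 c1 x0 xy yz.
have y0 := lt_le_trans x0 xy; have z0 := lt_le_trans y0 yz.
have dec u v : 0 < u -> u <= v -> v `^ (c - 1) <= u `^ (c - 1).
  move=> u0 uv; rewrite -(opprB 1 c) !powRN lef_pV2 ?posrE ?powR_gt0//.
    by rewrite ge0_ler_powR ?nnegrE ?subr_ge0// ?ltW// (lt_le_trans u0).
  exact: lt_le_trans uv.
rewrite -(mulr_powRB1 (ltW z0) c0) -(mulr_powRB1 (ltW y0) c0).
apply: (@le_trans _ _ (y `^ (c - 1) * (z - y))).
  by rewrite mulrBr [_ * z]mulrC [_ * y]mulrC lerD2r ler_wpM2l ?dec// ltW.
by rewrite ler_wpM2r ?subr_ge0// dec.
Qed.

(** The slope can be large only just to the right of [s]. Clipping t - s from above at a level x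
    gives a monotone part with values in [0, x^c]; clipping it from below gives a part with
    Lipschitz constant x^(c - 1). *)
Lemma absolutely_continuous01_powR (s c : R) : 0 < c -> c <= 1 ->
  absolutely_continuous01 (fun t : R => (Num.max 0 (t - s) `^ c)%:C : Cplx R).
Proof.
move=> c0 c1.
apply: (absolutely_continuous01_split (f := fun t => Num.max 0 (t - s) `^ c)).
(* The level [x] solves x^c = e. *)
move=> e e0; pose x := e `^ c^-1.
have x0 : 0 < x by rewrite powR_gt0.
have xc : x `^ c = e by rewrite -powRrM mulVf ?gt_eqF// powRr1// ltW.
exists (fun t => Num.min (Num.max 0 (t - s)) x `^ c),
  (fun t => Num.max (t - s) x `^ c - x `^ c), (x `^ (c - 1)).
have ub t : 0 <= Num.min (Num.max 0 (t - s)) x.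
  by rewrite le_min le_max lexx /= ltW.
split.
- move=> t /=; have [tx|xt] := leP (t - s) x.
    rewrite subrr addr0 min_l// ge_max tx andbT ltW//.
  rewrite max_r; last by rewrite ltW// (lt_trans x0).
  by rewrite min_r ?ltW// addrCA subrr addr0.
- move=> u v uv /=; apply: ge0_ler_powR; rewrite ?nnegrE// ?(ltW c0)//.
  by apply: le_min2; rewrite ?lexx//; apply: le_max2; rewrite ?lexx// lerD2r.
- move=> t; rewrite powR_ge0 /= -xc; apply: ge0_ler_powR; rewrite ?nnegrE// ?(ltW c0) ?(ltW x0)//.
  by rewrite ge_min lexx orbT.
- exact: powR_ge0.
move=> u v uv /=; rewrite opprB addrA subrK.
have mx : Num.max (u - s) x <= Num.max (v - s) x.
  by apply: le_max2; rewrite ?lexx// lerD2r.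
have xm : x <= Num.max (u - s) x by rewrite le_max lexx orbT.
rewrite ger0_norm; last first.
  rewrite subr_ge0; apply: ge0_ler_powR; rewrite ?nnegrE// ?(ltW c0)//.
    by rewrite ltW// (lt_le_trans x0).
  by rewrite ltW// (lt_le_trans x0)// (le_trans xm).
apply: (le_trans (powR_increment_le c0 c1 x0 xm mx)).
rewrite ler_wpM2l ?powR_ge0//.
have [ux|xu] := leP (u - s) x; have [vx|xv] := leP (v - s) x => //; lra.
Qed.

End absolute_continuity.

(** * Membership in L^p as finiteness of an integral *)

Section Lp.
Context (R : realType).

Lemma normc_ge0 (z : Cplx R) : 0 <= Normc.normc z.
Proof. by case: z => x y; exact: sqrtr_ge0. Qed.

Lemma measurable_fun_normc (D : set R) (g : R -> Cplx R) : measurable D ->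
  measurable_fun D (fun t => complex.Re (g t)) ->
  measurable_fun D (fun t => complex.Im (g t)) ->
  measurable_fun D (fun t => Normc.normc (g t)).
Proof.
move=> mD mRe mIm.
have -> : (fun t => Normc.normc (g t)) =
    Num.sqrt \o (fun t => complex.Re (g t) ^+ 2 + complex.Im (g t) ^+ 2).
  by apply/funext => t /=; case: (g t).
apply: measurableT_comp.
  by apply: continuous_measurable_fun; exact: sqrt_continuous.
by apply: measurable_funD; exact: measurable_funX.
Qed.

(** The outer exponent 1/q preserves finiteness in both directions, and the extension by 0 adds
    nothing to the integral because 0^q = 0 for q > 0. *)
Lemma Lnorm_normc_lty (q : R) (g : R -> Cplx R) : 0 < q ->
  ('N[@lebesgue_measure R]_q%:E[
     (fun t => (Normc.normc (g t))%:E) \_ `[(0 : R)%R, 1%R]] < +oo)%E <->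
  (\int[lebesgue_measure]_(t in `[0%R, 1%R]) (Normc.normc (g t) `^ q)%:E < +oo)%E.
Proof.
move=> q0.
have -> : (\int[lebesgue_measure]_(t in `[0%R, 1%R]) (Normc.normc (g t) `^ q)%:E =
    \int[lebesgue_measure]_t
      (`| ((fun t => (Normc.normc (g t))%:E) \_ `[(0 : R)%R, 1%R]) t | `^ q))%E.
  rewrite integral_mkcond; apply: eq_integral => t _.
  rewrite !patchE; case: ifPn => _.
    by rewrite -poweR_EFin /= ger0_norm// normc_ge0.
  by rewrite /point /= normr0 powR0 ?gt_eqF.
rewrite unlock; split => [|/poweR_lty]; last exact.
by apply: lty_poweRy; rewrite invr_eq0 gt_eqF.
Qed.

(** This treats finite and infinite p alike: [0, 1] has measure 1, so an essential bound [K] gives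
    an integral of at most K^q. *)
Lemma in_Lp01_integral_lty (p : \bar R) (q : R) (g : R -> Cplx R) : 0 < q ->
  p = q%:E \/ p = +oo%E -> in_Lp01 p g ->
  (\int[lebesgue_measure]_(t in `[0%R, 1%R]) (Normc.normc (g t) `^ q)%:E < +oo)%E.
Proof.
move=> q0 [->|->] [mRe mIm gLp]; first exact/Lnorm_normc_lty.
move: gLp; rewrite unlock.
(* The norm for p = +oo is the essential supremum only when the whole space has positive measure, so
   this selects the right branch. *)
have -> : (0 < @lebesgue_measure R [set: R])%E.
  apply: (@lt_le_trans _ _ (@lebesgue_measure R `[0, 1]%classic)).
    by rewrite lebesgue_measure_itv /= lte_fin ltr01 oppr0 adde0 lte01.
  by apply: le_measure; rewrite ?inE.
set S := ess_sup _ _ => S_lty.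
(* A priori [S] may also be -oo, and then K = 0 serves. *)
have [K [K0 SK]] : exists K : R, 0 <= K /\ (S <= K%:E)%E.
  case: S S_lty => [x _||_] //.
    by exists `|x|; rewrite normr_ge0 lee_fin ler_norm.
  by exists 0; rewrite lexx leNye.
have aeK := (@ess_supP _ _ _ lebesgue_measure _ _ SK).
apply: (@le_lt_trans _ _ (\int[lebesgue_measure]_(t in `[(0:R)%R, 1%R]) (cst (K `^ q)%:E) t)%E).
  apply: ae_ge0_le_integral => //.
  - by move=> t _; rewrite lee_fin powR_ge0.
  - apply/measurable_EFinP; apply: (measurableT_comp (@measurable_powR R q)).
    exact: measurable_fun_normc.
  - by move=> t _; rewrite lee_fin powR_ge0.
  apply: filterS aeK => t /=; rewrite patchE => + t01.
  rewrite mem_set//= lee_fin ger0_norm ?normc_ge0// => gK.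
  by rewrite lee_fin ge0_ler_powR ?nnegrE ?normc_ge0// ltW.
rewrite integral_cst//= lebesgue_measure_itv /= lte_fin ltr01 oppr0 adde0 mule1.
exact: ltry.
Qed.

End Lp.

(** * The identity and the shifted power belong to AC_r *)

Section test_functions.
Context (R : realType).

Lemma in_ACp_id (r : R) : 0 < r -> in_ACp r%:E (fun t : R => t%:C : Cplx R).
Proof.
move=> r0; split; [exact: absolutely_continuous01_id|by []|].
exists (cst 1).
  by apply: aeW => t _; exact: (is_derive_has_derivative (is_derive_id t 1)).
split; [exact: measurable_cst|exact: measurable_cst|].
apply/Lnorm_normc_lty => //.
rewrite (eq_integral (cst 1%E)); last by move=> t _; rewrite Normc.normc1 powR1.
rewrite integral_cst//= mul1e lebesgue_measure_itv /= lte_fin ltr01 oppr0 adde0.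
exact: ltry.
Qed.

(** To the left of [s] the formula still gives the derivative 0, by the convention 0^a = 0 for a !=
    0, applied to a = c - 1. *)
Lemma is_derive_max_powR (s c t : R) : c != 1 -> t != s ->
  is_derive t 1 (fun x => Num.max 0 (x - s) `^ c)
                (c * Num.max 0 (t - s) `^ (c - 1)).
Proof.
move=> c1; rewrite neq_lt => /orP[ts|st].
  rewrite max_l ?subr_le0 ?ltW// powR0 ?subr_eq0// mulr0.
  apply: (@near_eq_is_derive _ _ _ (cst (0 `^ c))) => //.
  near=> x; rewrite /= max_l// subr_le0 ltW//; near: x; exact: lt_nbhsl.
rewrite max_r ?subr_ge0 ?ltW//.
apply: (@near_eq_is_derive _ _ _ (fun x => (x - s) `^ c)) => //.
  near=> x; rewrite /= max_r// subr_ge0 ltW//; near: x; exact: lt_nbhsr.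
exact: is_derive1_shift_powR.
Unshelve. all: by end_near. Qed.

(** The condition 1 + (c - 1) r > 0 makes the r-th power of the derivative, a multiple of (t -
    s)^((c - 1) r), integrable at [s]. *)
Lemma in_ACp_powR (r s c : R) : 0 <= s -> s < 1 -> 0 < r -> 0 < c -> c < 1 ->
  0 < 1 + (c - 1) * r ->
  in_ACp r%:E (fun t : R => (Num.max 0 (t - s) `^ c)%:C : Cplx R).
Proof.
move=> s0 s1 r0 c0 c1; set d := 1 + _ => d0; split.
- by apply: absolutely_continuous01_powR => //; exact: ltW.
- by rewrite max_l ?sub0r ?oppr_le0// powR0 ?gt_eqF.
exists (fun t => (c * Num.max 0 (t - s) `^ (c - 1))%:C).
  exists [set s]; split => //; first exact: lebesgue_measure_set1.
  move=> t /= /not_implyP[_ nder]; apply: contrapT => /eqP ts; apply: nder.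
  apply: is_derive_has_derivative; apply: is_derive_max_powR.
    by rewrite lt_eqF.
  exact: ts.
split; [|exact: measurable_cst|].
  apply: measurable_funM => //.
  apply: (measurableT_comp (@measurable_powR R (c - 1))).
  by apply: measurable_maxr => //; exact: measurable_funB.
apply/Lnorm_normc_lty => //.
(* Here d - 1 = (c - 1) r, and dividing by [d] exhibits a multiple of the derivative of (t - s)^d.
   On [0, s] the integrand vanishes since 0^(c - 1) = 0. *)
have -> : (\int[lebesgue_measure]_(t in `[0%R, 1%R])
      (Normc.normc (c * Num.max 0 (t - s) `^ (c - 1))%:C `^ r)%:E =
    \int[lebesgue_measure]_(t in `]s, 1%R])
      ((c `^ r / d)%:E * (d * (t - s) `^ (d - 1))%:E))%E.
  rewrite integral_mkcond [RHS]integral_mkcond; apply: eq_integral => t _.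
  rewrite !patchE normc_real !mem_setE !in_itv /=.
  rewrite ger0_norm ?mulr_ge0 ?powR_ge0 ?(ltW c0)//.
  have [st|ts] := ltP s t.
    rewrite (le_trans s0 (ltW st)) /=; case: (t <= 1) => //.
    rewrite max_r ?subr_ge0 ?(ltW st)// -EFinM mulrA divfK ?gt_eqF//.
    rewrite powRM ?powR_ge0 ?(ltW c0)// -powRrM.
    by rewrite /d addrAC subrr add0r.
  rewrite /= max_l ?subr_le0// powR0 ?subr_eq0 ?lt_eqF// mulr0 powR0 ?gt_eqF//.
  by case: (_ && _).
have f0 t : (0 <= (d * (t - s) `^ (d - 1))%:E)%E.
  by rewrite lee_fin mulr_ge0 ?powR_ge0 ?ltW.
rewrite ge0_integralZl//; last 2 first.
- apply/measurable_EFinP; apply: measurable_funM => //.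
  apply: (measurableT_comp (@measurable_powR R (d - 1))).
  by apply: measurable_funB.
- by rewrite lee_fin divr_ge0 ?powR_ge0 ?ltW.
apply: lte_mul_pinfty; [|by []|exact: integral_shift_powR_lty].
by rewrite lee_fin divr_ge0 ?powR_ge0 ?ltW.
Qed.

End test_functions.

(** * Estimates for a multiplier that is nonzero at some point *)

Lemma normcB_gt_half (R : realType) (u v : Cplx R) :
  Normc.normc (u - v) < Normc.normc u / 2 ->
  Normc.normc u / 2 <= Normc.normc v <= 2 * Normc.normc u.
Proof.
move=> uv.
have := le_normcD (u - v) v; rewrite subrK => h1.
have := le_normcD (v - u) u; rewrite subrK -opprB normcN => h2.
have u0 := normc_ge0 u.
by apply/andP; split; lra.
Qed.

Lemma multiplier_interval (R : realType) (m : R -> Cplx R) (t0 : R) :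
  {within `]0, 1], continuous m} -> 0 < t0 <= 1 -> m t0 != 0 ->
  exists s t1 k K : R, [/\ 0 < s, s < t1, t1 < 1, 0 < k &
    forall t, s < t -> t <= t1 -> k <= Normc.normc (m t) <= K].
Proof.
move=> mc t001 mt0; have /andP[t00 t01] := t001.
have k0 : 0 < Normc.normc (m t0).
  rewrite lt_neqAle normc_ge0 andbT eq_sym.
  by apply/eqP => /Normc.eq0_normc/eqP; exact/negP.
have mt : m t @[t --> within `]0, 1] (nbhs t0)] --> m t0.
  have t0I : `]0, 1]%classic t0 by rewrite /= in_itv /= t00.
  by rewrite (nbhs_subspace_in t0I); exact: mc.
move/cvgrPdist_lt : mt => /(_ (Normc.normc (m t0) / 2)%:C).
rewrite ltcR divr_gt0// => /(_ isT).
rewrite /prop_near1 /within /= => /nbhs_ballP[e /= e0 be].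
(* The first bound keeps [s] positive, the second keeps []s, t0[] within distance e of [t0]. Ending
   at the midpoint of [s] and [t0] gives t1 < 1 even if t0 = 1. *)
pose s := Num.max (t0 / 2) (t0 - e / 2).
have s0 : 0 < s by rewrite lt_max divr_gt0.
have st0 : s < t0.
  by rewrite gt_max; apply/andP; split; lra.
have [st1 t1t0] := midf_lt st0.
exists s, ((s + t0) / 2), (Normc.normc (m t0) / 2), (2 * Normc.normc (m t0)).
split => //; first exact: lt_le_trans t01.
  by rewrite divr_gt0.
move=> t st tt1; have tt0 := le_lt_trans tt1 t1t0.
have es : t0 - e / 2 <= s by rewrite le_max lexx orbT.
apply: normcB_gt_half.
rewrite -ltcR -normr_normc; apply: be.
  by rewrite /ball /= ger0_norm ?subr_ge0 1?ltW//; lra.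
by rewrite in_itv /= (lt_trans s0 st) (le_trans (ltW tt0) t01).
Qed.

(** The sum is at most three times the maximum, and the q-th power of the maximum is one of the
    three summands on the right. *)
Lemma powR_add3_le (R : realType) (q x y z : R) : 0 < q ->
  0 <= x -> 0 <= y -> 0 <= z ->
  (x + y + z) `^ q <= 3 `^ q * (x `^ q + y `^ q + z `^ q).
Proof.
move=> q0 x0 y0 z0; pose w := Num.max x (Num.max y z).
have w0 : 0 <= w by rewrite le_max x0.
have xyz : x + y + z <= 3 * w.
  have : x <= w by rewrite le_max lexx.
  have : y <= w by rewrite !le_max lexx orbT.
  have : z <= w by rewrite !le_max lexx !orbT.
  lra.
apply: (@le_trans _ _ ((3 * w) `^ q)).
  by apply: ge0_ler_powR; rewrite ?nnegrE ?(ltW q0) ?addr_ge0 ?mulr_ge0.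
rewrite powRM// ler_wpM2l ?powR_ge0//.
have := powR_ge0 x q; have := powR_ge0 y q; have := powR_ge0 z q.
by rewrite /w; case: (leP y z) => _; case: (leP x _) => _; lra.
Qed.

(** Near t, both M(x) f(x) and N(x) x equal m(x) x f(x). Comparing their product-rule derivatives
    calls for no derivative of [m]. *)
Lemma multiplier_derivative_eq (R : realType) (t : R) (m M N : R -> Cplx R)
    (f : R -> R) (M' N' : Cplx R) (f' : R) :
  0 < t < 1 ->
  (forall x, 0 < x -> x < 1 -> M x = m x * x%:C) ->
  (forall x, 0 < x -> x < 1 -> N x = m x * (f x)%:C) ->
  has_derivative M t M' -> has_derivative N t N' -> is_derive t 1 f f' ->
  m t * t%:C * f'%:C = N' * t%:C + m t * (f t)%:C - M' * (f t)%:C.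
Proof.
move=> /andP[t0 t1] ME NE dM dN /is_derive_has_derivative df.
have did := is_derive_has_derivative (is_derive_id t 1).
have Mf := has_derivativeM dM df.
have Nid := has_derivativeM dN did.
have : M' * (f t)%:C + M t * f'%:C = N' * t%:C + N t * 1%:C.
  apply: (has_derivative_unique Mf); apply: near_has_derivative Nid.
  near=> x; have x0 : 0 < x by near: x; exact: lt_nbhsr.
  have x1 : x < 1 by near: x; exact: lt_nbhsl.
  by rewrite ME// NE// mulrAC.
rewrite ME// NE// mulr1 => <-; ring.
Unshelve. all: by end_near. Qed.


(** Here [w], [y], [y'] stand for m(t), f(t), f'(t). The left side of the equation has modulus at
    least k s y', the right side at most |N'| + K + |M'|, as t and y are at most 1. *)
Lemma multiplier_derivative_le (R : realType) (s t k K : R) (w M' N' : Cplx R)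
    (y y' : R) :
  0 < s -> s < t -> t < 1 -> 0 < k -> k <= Normc.normc (w) <= K ->
  0 <= y <= 1 -> 0 <= y' ->
  w * t%:C * y'%:C = N' * t%:C + w * y%:C - M' * y%:C ->
  y' <= (1 + K) / (k * s) * (Normc.normc N' + Normc.normc M' + 1).
Proof.
move=> s0 st t1 k0 /andP[km mK] /andP[y0 y1] y'0 /(congr1 (@Normc.normc R)) E.
have t0 := lt_trans s0 st.
have K0 : 0 <= K := le_trans (le_trans (ltW k0) km) mK.
have nM := normc_ge0 M'; have nN := normc_ge0 N'.
have bound : k * s * y' <= Normc.normc N' + K + Normc.normc M'.
  apply: (@le_trans _ _ (Normc.normc (w * t%:C * y'%:C))).
    rewrite !Normc.normcM !normc_real (ger0_norm y'0) (gtr0_norm t0).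
    by rewrite ler_wpM2r// ler_pM// ltW.
  rewrite E; apply: (le_trans (le_normcD _ _)).
  rewrite normcN !Normc.normcM !normc_real (ger0_norm y0).
  apply: lerD; last by rewrite ler_piMr.
  apply: (le_trans (le_normcD _ _)).
  rewrite !Normc.normcM !normc_real (ger0_norm y0) (gtr0_norm t0).
  apply: lerD; first by rewrite ler_piMr// ltW.
  by rewrite -[leRHS]mulr1 ler_pM// normc_ge0.
rewrite mulrAC ler_pdivlMr ?mulr_gt0// mulrC; apply: (le_trans bound).
(* What remains is |N'| + K + |M'| <= (1 + K) (|N'| + |M'| + 1). *)
nra.
Qed.

(** Raising the bound to the power q would dominate 1/(t - s), whose integral diverges at [s], by an
    integrable function. *)
Lemma powRN_inv_not_dominated (R : realType) (p : \bar R) (s t1 q C : R)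
    (g h : R -> Cplx R) :
  0 < s -> s < t1 -> t1 < 1 -> 0 < q -> p = q%:E \/ p = +oo%E -> 0 <= C ->
  in_Lp01 p g -> in_Lp01 p h ->
  ~ {ae @lebesgue_measure R, forall t, s < t <= t1 ->
      (t - s) `^ (- q^-1) <= C * (Normc.normc (g t) + Normc.normc (h t) + 1)}.
Proof.
move=> s0 st1 t11 q0 pq C0 gL hL dom.
have g_lty := in_Lp01_integral_lty q0 pq gL.
have h_lty := in_Lp01_integral_lty q0 pq hL.
pose I01 : set R := `[0, 1]%classic.
have mI : measurable I01 by exact: measurable_itv.
pose D : set R := `]s, t1]%classic.
have mD : measurable D by exact: measurable_itv.
have mpow u : in_Lp01 p u ->
    measurable_fun I01 (fun t => (Normc.normc (u t) `^ q)%:E).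
  move=> [mRe mIm _]; apply/measurable_EFinP.
  apply: (measurableT_comp (@measurable_powR R q)).
  exact: measurable_fun_normc.
pose B (t : R) := ((Normc.normc (g t) `^ q)%:E + (Normc.normc (h t) `^ q)%:E + 1)%E.
pose A : R := C `^ q * 3 `^ q.
have A0 : 0 <= A by rewrite mulr_ge0 ?powR_ge0.
have B0 t : (0 <= B t)%E by rewrite !adde_ge0// lee_fin powR_ge0.
have mB : measurable_fun I01 B.
  by apply: emeasurable_funD => //; apply: emeasurable_funD; exact: mpow.
have B_lty : (\int[lebesgue_measure]_(t in I01) B t < +oo)%E.
  have pow0 (u : R -> Cplx R) t : I01 t -> (0 <= (Normc.normc (u t) `^ q)%:E)%E.
    by move=> _; rewrite lee_fin powR_ge0.
  rewrite /B ge0_integralD//; last 2 first.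
  - by move=> t _; rewrite adde_ge0// lee_fin powR_ge0.
  - by apply: emeasurable_funD; exact: mpow.
  rewrite ge0_integralD//; [|by move=> t; exact: pow0|exact: mpow|by move=> t; exact: pow0|exact: mpow].
  apply: lte_add_pinfty; first exact: lte_add_pinfty.
  rewrite integral_cst//= mul1e /I01 lebesgue_measure_itv /= lte_fin ltr01 oppr0 adde0.
  exact: ltry.
suff : (\int[lebesgue_measure]_(t in D) ((t - s)^-1)%:E < +oo)%E.
  by rewrite integral_shift_invy.
(* The domination is used on []s, t1]] only; the nonnegative majorant is then integrated over all of
   [0, 1]. *)
apply: (@le_lt_trans _ _ (\int[lebesgue_measure]_(t in I01) (A%:E * B t))%E).
  have DI : D `<=` I01.
    move=> t; rewrite /D /I01 /= !in_itv /= => /andP[st tt1].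
    by rewrite (ltW (lt_trans s0 st)) (le_trans tt1 (ltW t11)).
  have mAB : measurable_fun I01 (fun t => A%:E * B t)%E.
    exact: measurable_funeM.
  apply: (@le_trans _ _ (\int[lebesgue_measure]_(t in D) (A%:E * B t))%E).
    apply: ae_ge0_le_integral => //.
    - by move=> t; rewrite /D /= in_itv /= => /andP[st _];
        rewrite lee_fin invr_ge0 subr_ge0 ltW.
    - apply/measurable_EFinP; apply: (@measurable_fun_ray _ _ s).
      + by move=> t; exact: continuous_shift_inv.
      + exact: mD.
      + by move=> t; rewrite /D /= !in_itv /= andbT => /andP[].
    - by move=> t _; rewrite mule_ge0.
    - exact: measurable_funS mAB.
    apply: (@filterS _ _ (ae_filter_ringOfSetsType (@lebesgue_measure R)) _ _ _ dom).
    move=> t {}dom; rewrite /D /= in_itv /= => st.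
    have /andP[st' _] := st.
    rewrite /B -!EFinD -EFinM lee_fin /A -mulrA.
    have -> : (t - s)^-1 = ((t - s) `^ (- q^-1)) `^ q.
      rewrite -powRrM mulNr mulVf ?gt_eqF// powR_inv1// subr_ge0 ltW//.
    apply: (@le_trans _ _ ((C * (Normc.normc (g t) + Normc.normc (h t) + 1)) `^ q)).
      apply: ge0_ler_powR; rewrite ?nnegrE ?powR_ge0 ?(ltW q0)//; last exact: dom.
      by rewrite mulr_ge0// !addr_ge0// normc_ge0.
    rewrite powRM ?addr_ge0 ?normc_ge0//.
    rewrite ler_wpM2l ?powR_ge0//.
    (* The constant 1 becomes 1^q, the third term of the inequality for powers of sums. *)
    rewrite -[X in _ <= _ * (_ + X)](_ : 1 `^ q = 1); last by rewrite powR1.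
    by apply: powR_add3_le; rewrite ?normc_ge0.
  apply: ge0_subset_integral => // t _; exact: mule_ge0.
by rewrite ge0_integralZl// lte_mul_pinfty.
Qed.

(** * Vanishing of the multiplier *)

Lemma multiplier_eq0 (R : realType) (r q : R) (p : \bar R) (T : ACp r%:E -> ACp p)
    (m : R -> Cplx R) (t0 : R) :
  1 <= r -> r < q -> p = q%:E \/ p = +oo%E ->
  {within `]0, 1], continuous m} ->
  (forall (g : ACp r%:E) t, 0 <= t <= 1 -> T g t = mul_ext0 m g t) ->
  0 < t0 <= 1 -> m t0 = 0.
Proof.
move=> r1 rq pq mc Tm t001; apply: contrapT => /eqP mt0.
have r0 : 0 < r by exact: lt_le_trans r1.
have q0 : 0 < q := lt_trans r0 rq.
have q1 : 1 < q := le_lt_trans r1 rq.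
have [s [t1 [k [K [s0 st1 t11 k0 mkK]]]]] := multiplier_interval mc t001 mt0.
(* With c - 1 = -1/q, r < q puts f' in L^r, while f'^q is a multiple of 1/(t - s) to the right of
   [s]. *)
pose c := 1 - q^-1.
have c0 : 0 < c by rewrite subr_gt0 invf_lt1.
have c1 : c < 1 by rewrite gtrBl invr_gt0.
have cE : c - 1 = - q^-1 by rewrite /c addrAC subrr add0r.
have rc : 0 < 1 + (c - 1) * r.
  by rewrite cE mulNr subr_gt0 mulrC ltr_pdivrMr// mul1r.
pose f (t : R) := Num.max 0 (t - s) `^ c.
have idP := in_ACp_id r0.
have fP := in_ACp_powR (ltW s0) (lt_trans st1 t11) r0 c0 c1 rc.
have TE g t : 0 < t -> t < 1 -> T g t = m t * g t.
  by move=> t0' t1'; rewrite Tm ?(ltW t0') ?(ltW t1')// /mul_ext0 gt_eqF.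
(* The products of [m] with the identity and with [f] are differentiable almost everywhere because
   they are values of [T], hence in AC_p. *)
have [_ _ [M' dM M'L]] := ACp_funP (T (MkACp idP)).
have [_ _ [N' dN N'L]] := ACp_funP (T (MkACp fP)).
have K0 : 0 <= K.
  have /andP[km mK] := mkK t1 st1 (lexx t1).
  by rewrite (le_trans _ mK)// (le_trans (ltW k0) km).
apply: (@powRN_inv_not_dominated _ p s t1 q (c^-1 * ((1 + K) / (k * s))) N' M') => //.
  by rewrite mulr_ge0 ?invr_ge0 ?(ltW c0)// divr_ge0 ?addr_ge0 ?mulr_ge0 ?(ltW k0) ?(ltW s0).
apply: (@filterS2 _ _ (ae_filter_ringOfSetsType (@lebesgue_measure R)) _ _ _ _ dM dN).
move=> t {}dM {}dN /andP[st tt1].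
have t0' := lt_trans s0 st; have t1' := le_lt_trans tt1 t11.
have t01 : 0 < t < 1 by rewrite t0'.
have df : is_derive t 1 f (c * Num.max 0 (t - s) `^ (c - 1)).
  by apply: is_derive_max_powR; [rewrite lt_eqF|rewrite gt_eqF].
have := multiplier_derivative_eq t01 (TE (MkACp idP)) (TE (MkACp fP))
  (dM t01) (dN t01) df.
move=> /(multiplier_derivative_le s0 st t1' k0 (mkK t st tt1)).
have ts0 : 0 < t - s by rewrite subr_gt0.
rewrite /f max_r ?(ltW ts0)// cE => H.
(* [H] bounds c (t - s)^(-1/q); moving c across accounts for [c^-1] in the constant. Its premise
   f(t) <= 1 holds as 0 < t - s < 1. *)
rewrite -[leRHS]mulrA -ler_pdivrMl ?invr_gt0// invrK; apply: H.
  rewrite powR_ge0 /= -[leRHS](_ : 1 `^ c = 1); last by rewrite powR1.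
  by apply: ge0_ler_powR; rewrite ?nnegrE ?ler01 ?(ltW c0) ?(ltW ts0)//; lra.
by rewrite mulr_ge0 ?powR_ge0// ltW.
Qed.

Theorem theorem4 (R : realType) (r p : \bar R)
    (hr : (1 <= r)%E) (hrp : (r < p)%E)
    (T : ACp r -> ACp p) (hT : is_multiplier T) :
  forall (g : ACp r) (t : R), (0 <= t <= 1)%R -> T g t = 0%R.
Proof.
case: r hr hrp T hT => [r| |] //= hr hrp T [m mc Tm] g t t01; last first.
  by rewrite ltNge leey in hrp.
rewrite Tm// /mul_ext0; case: eqVneq => // t0.
have t001 : 0 < t <= 1.
  by have /andP[t0' ->] := t01; rewrite lt_neqAle eq_sym t0 t0'.
(* A finite exponent above r is needed: p itself if finite, otherwise r + 1. *)
have [q [rq pq]] : exists q, r < q /\ (p = q%:E \/ p = +oo%E).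
  case: p hrp {T Tm} => [p| |] //= hrp; first by exists p; split; [|left].
  by exists (r + 1); split; [rewrite ltrDl|right].
by rewrite (multiplier_eq0 _ rq pq mc Tm t001) ?mul0r.
Qed.
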